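(* Let $D$ be an algebraically closed division ring with center $F$. If $p$ is a nonconstant polynomial in the central variable $x$ with coefficients in $F$, then the image of $p$ on $D$ coincides with $D$, that is, $p(D)=\{p(a)\mid a\in D\}=D$.
   Context: A polynomial in the central variable $x$ over a division ring $D$ is an expression $a_tx^t+\cdots+a_1x+a_0$ with $a_i\in D$, where $x$ commutes with all elements of $D$. An element $a\in D$ is a (right) root of it if $a_ta^t+\cdots+a_1a+a_0=0$. A division ring $D$ (commutative or not) is (right) algebraically closed if every nonconstant polynomial in a central variable with coefficients in $D$ has a (right) root in $D$. *)

(* Defs.v *)
From mathcomp Require Import all_boot all_algebra.
From mathcomp Require Import classical_sets.

Set Implicit Arguments.
Unset Strict Implicit.
Unset Printing Implicit Defensive.

Import GRing.Theory.

Local Open Scope ring_scope.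
Local Open Scope classical_set_scope.

(* [unitRingType] is not assumed commutative, and its units are the two-sided
   invertible elements ([unitrP]). *)
Definition division_ring (D : unitRingType) : Prop :=
  forall x : D, x != 0 -> x \is a GRing.unit.

Definition center (D : nzRingType) : set D :=
  [set z | forall y : D, GRing.comm z y].
Arguments center D : clear implicits.

(* In [{poly D}] the variable commutes with the coefficients, and [p.[a]] is the
   sum of the [p`_i * a ^+ i], coefficients on the left ([horner_coef]), so
   [root p a] says that [a] is a right root of [p]. *)
Definition right_algebraically_closed (D : nzRingType) : Prop :=
  forall p : {poly D}, (1 < size p)%N -> exists a : D, root p a.

(* Main.v *)
Require Import Defs.
From mathcomp Require Import all_boot all_algebra.
From mathcomp Require Import classical_sets.

Local Open Scope ring_scope.
Local Open Scope classical_set_scope.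

(** To hit a given [c], take a right root [a] of [p - c%:P]. With coefficients written on the left,
    evaluation at [a] is additive even when [D] is noncommutative, so [p.[a] - c = 0]. *)

Theorem theorem4p5 (D : unitRingType) (hD : division_ring D)
    (hclosed : right_algebraically_closed D)
    (p : {poly D}) (hpF : forall i : nat, center D p`_i)
    (hp : (1 < size p)%N) :
  [set p.[a] | a in [set: D]] = [set: D].
Proof.
apply/seteqP; split => // c _.
have hpc : (1 < size (p - c%:P)%R)%N.
  (* A constant has size at most 1, which is below [size p], so subtracting it leaves the size of
     [p] unchanged and the difference is still nonconstant. *)
  by rewrite size_polyDl // size_polyN (leq_ltn_trans (size_polyC_leq1 c)).
have [a /rootP] := hclosed _ hpc.
rewrite hornerD hornerN hornerC => /GRing.subr0_eq pac.
by exists a.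
Qed.
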